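(* Inverting decision with a single additional level of nondeterminism requires local certificates of size $\Omega(\log n)$ or global certificates of size $\Omega(n\log n)$. That is, there exists a distributed language $\mathcal L$ that is decided by a local decision algorithm of constant radius without any proof (i.e. $\mathcal L\in\Lambda_0$) such that, for every correct mixed nondeterministic scheme for the complement of $\mathcal L$ using local certificates of $f(n)$ bits per node and a global certificate of $g(n)$ bits on $n$-node instances, there is a constant $c>0$ such that for all sufficiently large $n$, $f(n)\ge c\log n$ or $g(n)\ge c\,n\log n$.
   Context: A network is a finite connected simple graph without loops; $n$ is its number of nodes. Nodes carry pairwise distinct identifiers, positive integers in a range polynomial in $n$ (at most $n^{\kappa}$ for a fixed constant $\kappa\ge 1$). Nodes may carry inputs. A distributed language is a set of graphs with inputs (membership does not depend on identifiers); its complement is the set of all graphs with inputs not in it. A local decision algorithm of radius $r$ (without proof) lets each node $v$ see its $r$-neighborhood (graph structure, identifiers and inputs within distance $r$) and output accept or reject; it decides $\mathcal L$ if for every labeled graph, all nodes accept if and only if the labeled graph is in $\mathcal L$. $\Lambda_0$ is the class of languages decided by such an algorithm with constant radius. A mixed nondeterministic scheme for a language $\mathcal L'$ consists of a verifier of constant radius $r\ge 1$. The prover provides one global certificate string seen by all nodes and a local certificate string to each node. Each node $v$ sees its $r$-neighborhood (graph structure, identifiers, inputs and local certificates of the nodes at distance at most $r$ from $v$) and the global certificate, and outputs accept or reject. The verifier is uniform: it does not know $n$. The scheme is correct if: for every $n$-node labeled graph in $\mathcal L'$ (with identifiers in the range above) there exist local certificates of $f(n)$ bits and a global certificate of $g(n)$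 bits making all nodes accept; and for every labeled graph not in $\mathcal L'$, for every choice of certificates, at least one node rejects. Because the verifier is uniform and receives no guarantee relating the number of nodes to the identifiers or the certificate lengths, the latter condition is required for all certificate lengths and all assignments of distinct positive integers as identifiers. *)

(* Defs.v *)
From HB Require Import structures.
From mathcomp Require Import all_boot all_order all_algebra all_fingroup.
From mathcomp Require Import finmap.
From mathcomp Require Import reals exp.

Set Implicit Arguments.
Unset Strict Implicit.
Unset Printing Implicit Defensive.

Import Order.TTheory GRing.Theory Num.Theory.

Local Open Scope fset_scope.

Definition bits := seq bool.

Record network (n : nat) := Network {
  edge : rel 'I_n;
  edge_sym : symmetric edge;
  edge_irrefl : irreflexive edge;
  network_gt0 : 0 < n;
  network_connected : forall u v : 'I_n, connect edge u v
}.

Record labeled_graph (n : nat) := LabeledGraph {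
  graph_of :> network n;
  input : 'I_n -> bits
}.

Definition isomorphic (n : nat) (G H : labeled_graph n) : Prop :=
  exists s : {perm 'I_n},
    (forall u v, edge H (s u) (s v) = edge G u v) /\
    (forall u, input H (s u) = input G u).

Lemma isomorphic_sym (n : nat) (G H : labeled_graph n) :
  isomorphic G H -> isomorphic H G.
Proof.
case=> s [sE sI]; exists s^-1%g; split=> [u v|u].
  by rewrite -sE !permKV.
by rewrite -sI permKV.
Qed.

(* The nodes of an n-node graph are represented by 'I_n; [language_iso] makes
   membership independent of this arbitrary naming of the nodes. *)
Record language := Language {
  in_language :> forall n : nat, labeled_graph n -> Prop;
  language_iso : forall (n : nat) (G H : labeled_graph n),
    isomorphic G H -> in_language G -> in_language H
}.

Lemma complement_iso (L : language) (n : nat) (G H : labeled_graph n) :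
  isomorphic G H -> ~ L n G -> ~ L n H.
Proof. by move=> /isomorphic_sym GH nLG /(language_iso GH). Qed.

Definition complement (L : language) : language :=
  @Language (fun n G => ~ L n G) (@complement_iso L).

Definition id_assignment (n : nat) (ids : 'I_n -> nat) : Prop :=
  injective ids /\ forall v, 0 < ids v.

Definition ids_in_range (R : realType) (kappa : R) (n : nat)
    (ids : 'I_n -> nat) : Prop :=
  forall v, ((ids v)%:R <= n%:R `^ kappa)%R.

(* The nodes at distance at most r from v, i.e. those reached from v by a walk
   of length at most r. *)
Definition ball (n : nat) (G : network n) (r : nat) (v : 'I_n) : {set 'I_n} :=
  [set u | [exists k : 'I_r.+1, exists p : k.-tuple 'I_n,
              path (edge G) v p && (last v p == u)]].

(* What a node sees when every node carries a label in X.  Nodes occur only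
   through their identifiers: a view consists of the identifier of the observing
   node, the (identifier, label) pairs of the visible nodes, and the pairs of
   identifiers of adjacent visible nodes.  As identifiers are pairwise distinct,
   this determines the labeled subgraph induced by the ball. *)
Record view (X : choiceType) := View {
  view_center : nat;
  view_nodes : {fset nat * X};
  view_links : {fset nat * nat}
}.

Definition local_view (X : choiceType) (n : nat) (G : network n) (r : nat)
    (ids : 'I_n -> nat) (lab : 'I_n -> X) (v : 'I_n) : view X :=
  View (ids v)
    [fset (ids u, lab u) | u in ball G r v]
    [fset (ids e.1, ids e.2) | e in [set e : 'I_n * 'I_n |
      [&& e.1 \in ball G r v, e.2 \in ball G r v & edge G e.1 e.2]]].

Record local_algorithm := LocalAlgorithm {
  alg_radius : nat;
  alg_accepts : view bits -> bool
}.

Definition decides (R : realType) (kappa : R) (A : local_algorithm)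
    (L : language) : Prop :=
  forall (n : nat) (G : labeled_graph n) (ids : 'I_n -> nat),
    id_assignment ids -> ids_in_range kappa ids ->
    (forall v, alg_accepts A (local_view G (alg_radius A) ids (input G) v))
    <-> L n G.

Definition Lambda0 (R : realType) (kappa : R) (L : language) : Prop :=
  exists A : local_algorithm, decides kappa A L.

(* In the views of a mixed verifier, the label of a node is the pair of its input
   and its local certificate; the first argument of [ver_accepts] is the global
   certificate. *)
Record mixed_verifier := MixedVerifier {
  ver_radius : nat;
  ver_radius_ge1 : 1 <= ver_radius;
  ver_accepts : bits -> view (bits * bits)%type -> bool
}.

Definition node_accepts (V : mixed_verifier) (n : nat) (G : labeled_graph n)
    (ids : 'I_n -> nat) (glob : bits) (cert : 'I_n -> bits) (v : 'I_n) : bool :=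
  ver_accepts V glob
    (local_view G (ver_radius V) ids (fun u => (input G u, cert u)) v).

(* The certificate sizes f n and g n are upper bounds on the lengths; soundness
   ranges over certificates of any lengths and unbounded identifiers. *)
Definition correct_scheme (R : realType) (kappa : R) (V : mixed_verifier)
    (L : language) (f g : nat -> nat) : Prop :=
  (forall (n : nat) (G : labeled_graph n) (ids : 'I_n -> nat),
     id_assignment ids -> ids_in_range kappa ids -> L n G ->
     exists (glob : bits) (cert : 'I_n -> bits),
       [/\ size glob <= g n,
           forall v, size (cert v) <= f n
         & forall v, node_accepts V G ids glob cert v]) /\
  (forall (n : nat) (G : labeled_graph n) (ids : 'I_n -> nat),
     id_assignment ids -> ~ L n G ->
     forall (glob : bits) (cert : 'I_n -> bits),
       exists v, ~~ node_accepts V G ids glob cert v).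

(* Main.v *)
Require Import Defs.
From mathcomp Require Import all_boot all_order all_algebra all_fingroup.
From mathcomp Require Import finmap zify lra.
From mathcomp Require Import boolp reals exp.
Set Implicit Arguments.
Unset Strict Implicit.
Unset Printing Implicit Defensive.
Import Order.TTheory GRing.Theory Num.Theory.

(** The language is "no node is marked".  For a verifier of radius r, take
    n-cycles with one marked node whose other nodes are cut, up to a remainder,
    into m blocks of b = 2r+1 nodes with consecutive identifiers; a permutation s of the blocks
    gives an instance of the complement.  If the certificates, indexed by
    identifiers, can take fewer than m! values, then two permutations s <> t get
    the same ones.  Some step of t, from block B to block B', goes backwards in the
    order of s, so the part of s from B' to B closes up into an unmarked cycle
    via this step of t; a ball of radius r meets at most two consecutive blocks, so
    each node of this cycle sees what it would see in the instance of s or of t,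
    and accepts.  Hence m! <= 2^(g+1) 2^((f+1)n), while log m! is of order
    n log n / r. *)

(** * Cycles and their local views *)

Definition ord_mod (n : nat) (n_gt0 : 0 < n) (i : nat) : 'I_n :=
  Ordinal (ltn_pmod i n_gt0).

Lemma ord_mod_val n (n_gt0 : 0 < n) (v : 'I_n) : ord_mod n_gt0 v = v.
Proof. by apply: val_inj; rewrite /= modn_small. Qed.

Lemma ordS_mod n (n_gt0 : 0 < n) i : ordS (ord_mod n_gt0 i) = ord_mod n_gt0 i.+1.
Proof. by apply: val_inj; rewrite /= -addn1 modnDml addn1. Qed.

Definition cycle_edge (n : nat) : rel 'I_n :=
  fun u v => (u != v) && ((ordS u == v) || (ordS v == u)).

Lemma cycle_edge_sym n : symmetric (@cycle_edge n).
Proof. by move=> u v; rewrite /cycle_edge eq_sym orbC. Qed.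

Lemma cycle_edge_irrefl n : irreflexive (@cycle_edge n).
Proof. by move=> u; rewrite /cycle_edge eqxx. Qed.

Lemma cycle_connected n (u v : 'I_n) : connect (@cycle_edge n) u v.
Proof.
have n_gt0 : 0 < n by apply: leq_trans (ltn_ord u).
have from_u i : connect (@cycle_edge n) u (ord_mod n_gt0 (u + i)).
  elim: i => [|i IHi]; first by rewrite addn0 ord_mod_val connect0.
  apply: connect_trans IHi _; rewrite addnS -ordS_mod.
  case: (eqVneq (ord_mod n_gt0 (u + i)) (ordS (ord_mod n_gt0 (u + i)))) => [<-|neq].
    exact: connect0.
  by apply: connect1; rewrite /cycle_edge neq eqxx.
have := from_u (v + (n - u)).
have -> : u + (v + (n - u)) = v + n by have := ltn_ord u; lia.
congr connect; apply: val_inj; rewrite /= modnDr modn_small //.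
Qed.

Definition cycle_network (n : nat) (n_gt0 : 0 < n) : network n :=
  Network (@cycle_edge_sym n) (@cycle_edge_irrefl n) n_gt0 (@cycle_connected n).

Section CycleView.
Variables (n : nat) (n_gt0 : 0 < n).
Local Notation pos := (ord_mod n_gt0).

Lemma cycle_edge_mod s d e : d.+1 < n -> e.+1 < n ->
  cycle_edge (pos (s + d)) (pos (s + e)) = (d.+1 == e) || (e.+1 == d).
Proof.
move=> dn en; rewrite /cycle_edge !ordS_mod -!val_eqE /= -!addnS !eqn_modDl.
rewrite !modn_small; lia.
Qed.

(** The start is written [s + k] so that the window begins at [s] without truncated subtraction. In
    the induction, a first step forward moves the window to [s + 2], a step backward leaves it at
    [s]. *)
Lemma cycle_path_last k s (p : seq 'I_n) :
  size p = k -> path (@cycle_edge n) (pos (s + k)) p ->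
  exists2 d, d <= 2 * k & last (pos (s + k)) p = pos (s + d).
Proof.
elim: k s p => [|k IHk] s [|w p] //=; first by exists 0.
move=> [sz] /andP[/andP[_ /orP[/eqP|/eqP]]].
  rewrite ordS_mod => <-.
  have -> : (s + k.+1).+1 = s + 2 + k by lia.
  move=> /(IHk _ _ sz)[d dk ->]; exists (d + 2); first by lia.
  by congr pos; lia.
move=> wE; have -> : w = pos (s + k).
  apply: (bij_inj (ordS_bij n)); rewrite wE ordS_mod; congr pos; lia.
by move=> /(IHk _ _ sz)[d dk ->]; exists d => //; lia.
Qed.

Lemma cycle_path_forward s k : 1 < n -> exists p : seq 'I_n,
  [/\ size p = k, path (@cycle_edge n) (pos s) p & last (pos s) p = pos (s + k)].
Proof.
move=> n_gt1; elim: k s => [|k IHk] s; first by exists [::]; rewrite addn0.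
have [p [sz pp lp]] := IHk s.+1; exists (pos s.+1 :: p) => /=; split.
- by rewrite sz.
- rewrite pp andbT /cycle_edge ordS_mod eqxx /= -val_eqE /= andbT.
  rewrite -[s in s %% _]addn0 -[s.+1]addn1 eqn_modDl mod0n modn_small //.
- by rewrite lp; congr pos; lia.
Qed.

Lemma cycle_path_backward s k : 1 < n -> exists p : seq 'I_n,
  [/\ size p = k, path (@cycle_edge n) (pos (s + k)) p & last (pos (s + k)) p = pos s].
Proof.
move=> /(cycle_path_forward s k)[p [sz pp lp]].
exists (rev (belast (pos s) p)); rewrite size_rev size_belast -lp rev_path.
split=> //; first by rewrite (@eq_path _ _ (@cycle_edge n)) // => y z; apply: cycle_edge_sym.
by case: p {sz pp lp} => //= x p; rewrite rev_cons last_rcons.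
Qed.

Lemma ball_cycle r s : 1 < n ->
  ball (cycle_network n_gt0) r (pos (s + r)) =
  [set pos (s + d) | d : 'I_(2 * r).+1].
Proof.
move=> n_gt1; apply/setP=> u; rewrite inE; apply/existsP/imsetP.
  move=> [k /existsP[p /andP[pp /eqP <-]]].
  have kr : k <= r by rewrite -ltnS.
  move: pp; have -> : s + r = s + (r - k) + k by lia.
  move=> /(cycle_path_last (size_tuple p))[d dk ->].
  have dr : r - k + d < (2 * r).+1 by lia.
  by exists (Ordinal dr) => //=; rewrite addnA.
move=> [d _ ->]; have dr := ltn_ord d.
have [k [p [kr sz pp lp]]] : exists k (p : seq 'I_n), [/\ k < r.+1, size p = k,
    path (@cycle_edge n) (pos (s + r)) p & last (pos (s + r)) p = pos (s + d)].
  case: (leqP r d) => rd.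
    have [p [sz pp lp]] := cycle_path_forward (s + r) (d - r) n_gt1.
    exists (d - r), p; split=> //; first by lia.
    by rewrite lp; congr pos; lia.
  have [p [sz pp lp]] := cycle_path_backward (s + d) (r - d) n_gt1.
  have E : s + d + (r - d) = s + r by lia.
  by exists (r - d), p; split=> //; rewrite -?E //; lia.
exists (Ordinal kr); apply/existsP; exists (Tuple (introT eqP sz)).
by rewrite /= pp lp eqxx.
Qed.

(** The bound on [n] keeps the window from closing up: its two ends are not adjacent, so links join
    exactly the consecutive offsets. *)
Lemma cycle_local_view (X : choiceType) (ids : 'I_n -> nat) (lab : 'I_n -> X) r s :
  (2 * r).+1 < n ->
  local_view (cycle_network n_gt0) r ids lab (pos (s + r)) =
  View (ids (pos (s + r)))
    [fset (ids (pos (s + val d)), lab (pos (s + val d))) | d in 'I_(2 * r).+1]%fset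
    [fset (ids (pos (s + val e.1)), ids (pos (s + val e.2))) |
       e in [set e : 'I_(2 * r).+1 * 'I_(2 * r).+1 |
               (e.1.+1 == e.2 :> nat) || (e.2.+1 == e.1 :> nat)]]%fset.
Proof.
move=> rn; have n_gt1 : 1 < n by lia.
have lt_n (d : 'I_(2 * r).+1) : d.+1 < n by have := ltn_ord d; lia.
rewrite /local_view ball_cycle //; congr View; apply/fsetP=> x.
  apply/imfsetP/imfsetP => -[y /= yP ->].
    by have /imsetP[d _ ->] := yP; exists d.
  by exists (pos (s + y)) => //=; apply/imsetP; exists y.
apply/imfsetP/imfsetP => -[[y z] /=]; rewrite inE /=.
  move=> /and3P[/imsetP[d _ ->] /imsetP[e _ ->]].
  rewrite cycle_edge_mod // => de ->.
  by exists (d, e) => //=; rewrite inE.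
move=> yz ->; exists (pos (s + y), pos (s + z)) => //=.
by rewrite inE /= cycle_edge_mod // yz !imset_f.
Qed.

End CycleView.

(** [T] is a common pool of names carrying identifiers and labels, through which views in cycles of
    different lengths are compared. *)
Lemma cycle_local_view_eq (T : Type) (X : choiceType) (idt : T -> nat) (lab : T -> X)
    n1 n2 (n1_gt0 : 0 < n1) (n2_gt0 : 0 < n2)
    (u1 : 'I_n1 -> T) (u2 : 'I_n2 -> T) r s1 s2 :
  (2 * r).+1 < n1 -> (2 * r).+1 < n2 ->
  (forall d, d <= 2 * r ->
     u1 (ord_mod n1_gt0 (s1 + d)) = u2 (ord_mod n2_gt0 (s2 + d))) ->
  local_view (cycle_network n1_gt0) r (fun v => idt (u1 v)) (fun v => lab (u1 v))
    (ord_mod n1_gt0 (s1 + r)) =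
  local_view (cycle_network n2_gt0) r (fun v => idt (u2 v)) (fun v => lab (u2 v))
    (ord_mod n2_gt0 (s2 + r)).
Proof.
move=> rn1 rn2 u12; rewrite !cycle_local_view // u12; last by lia.
by congr View; apply: eq_imfset => //= d; rewrite !u12 // -ltnS.
Qed.

(** * Factorials against the number of certificates *)

Lemma expn_leq_fact d m : d ^ (m - d) <= m`!.
Proof.
elim: m => [|m IHm] //; case: (leqP d m) => dm.
  by rewrite subSn // expnS factS leq_mul // leqW.
by move: dm; rewrite -subn_eq0 => /eqP->; rewrite fact_gt0.
Qed.

(** With [d] about the square root of [n], at least half of the factors of [m!] exceed [d], so the
    binary logarithm of [m!] is of order [n * l / b]. *)
Lemma certificates_lt_fact b n f g : 0 < b -> 2 ^ (64 * b) <= n ->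
  64 * b * f < (trunc_log 2 n).+1 -> 64 * b * g < n * (trunc_log 2 n).+1 ->
  2 ^ g.+1 * (2 ^ f.+1) ^ n < (n.-1 %/ b)`!.
Proof.
move=> b_gt0 nb; have n_gt0 : 0 < n by apply: leq_trans nb; rewrite expn_gt0.
have := trunc_log_max (p := 2) isT nb; have := trunc_logP (p := 2) isT n_gt0.
set l := trunc_log 2 n => ln bl fl gl.
pose a := l %/ 2; pose d := 2 ^ a; set m := _ %/ b.
have al : l.+1 <= 4 * a by rewrite /a; lia.
have ad : a < d by apply: ltn_expl.
have ddn : d * d <= n.
  by apply: leq_trans ln; rewrite -expnD leq_exp2l // /a; lia.
have bd : 32 * b <= d by rewrite /a in ad *; lia.
have dn : 32 * b * d <= n by apply: leq_trans ddn; rewrite leq_mul2r bd orbT.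
have mn : n.-1 < m.+1 * b by rewrite /m ltn_ceil.
have dm : 2 * d <= m by rewrite /m leq_divRL //; nia.
have nm : n <= 4 * b * (m - d).
  have : m <= 2 * (m - d) by lia.
  have : n <= 2 * b * m by nia.
  move=> h1 h2; apply: (leq_trans h1).
  by have := leq_mul (leqnn (2 * b)) h2; lia.
apply: leq_trans (expn_leq_fact d m); rewrite -!expnM -expnD ltn_exp2l //.
have key : n * l.+1 <= 16 * b * (a * (m - d)).
  by have := leq_mul nm al; lia.
(* Here 64 is 4 * 16: scaled by [64 * b], the left side has four terms, from [g], [f * n], [n] and
   1, each at most [n * l.+1] and the first strictly smaller; [key] absorbs the four. *)
rewrite -(ltn_pmul2l (m := 64 * b)); last by lia.
have h1 : n * (64 * b * f) <= n * l by rewrite leq_mul2l -ltnS fl orbT.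
have h2 : n * (64 * b) <= n * l by rewrite leq_mul2l bl orbT.
have h3 : l <= n * l by rewrite leq_pmull.
lia.
Qed.

(** * Permutations that order the blocks differently *)

Lemma increasing_perm m (s : {perm 'I_m}) :
  (forall i j : 'I_m, j = i.+1 :> nat -> s i < s j) -> s = 1%g.
Proof.
move=> s_incr.
(* Induction from the bottom gives [i <= s i], and from the top [s i <= i]. *)
have le_s (k : nat) (i : 'I_m) : k = i -> i <= s i.
  elim: k i => [|k IHk] i ki; first by rewrite -ki.
  have km : k < m by have := ltn_ord i; lia.
  by have := IHk (Ordinal km) erefl; have := s_incr (Ordinal km) i (esym ki) => /=; lia.
have s_le k (i : 'I_m) : m = i + k.+1 -> s i + k.+1 <= m.
  elim: k i => [|k IHk] i ki; first by have := ltn_ord (s i); lia.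
  have im : i.+1 < m by lia.
  have := IHk (Ordinal im) _; have := s_incr i (Ordinal im) erefl => /=; lia.
apply/permP => i; apply: val_inj; rewrite perm1 /=.
have := le_s _ i erefl; have := s_le (m - i).-1 i _; have := ltn_ord i; lia.
Qed.

(** The positions in [s] of the successive values of [t] form the permutation [t * s^-1]; if it
    increased at every step, it would be the identity, giving [s = t]. *)
Lemma perm_backward_step m (s t : {perm 'I_m}) : s != t ->
  exists i j p q : 'I_m, [/\ j = i.+1 :> nat, p < q, s p = t j & s q = t i].
Proof.
move=> st; pose f := (t * s^-1)%g.
have [/existsP[i /existsP[j /andP[/eqP ji fji]]]|] :=
    boolP [exists i : 'I_m, exists j : 'I_m, (j == i.+1 :> nat) && (f j < f i)].
  by exists i, j, (f j), (f i); split; rewrite // permM permKV.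
rewrite negb_exists => /forallP nf; case/negP: st.
suff /(congr1 (mulg^~ s)) : f = 1%g by rewrite mulgKV mul1g => ->.
apply: increasing_perm => i j ji; have := nf i; rewrite negb_exists.
move=> /forallP/(_ j); rewrite ji eqxx /= -leqNgt leq_eqVlt => /orP[|//].
by rewrite (inj_eq val_inj) (inj_eq perm_inj) => /eqP ij; move: ji; rewrite ij; lia.
Qed.

(** * Permuting blocks of positions *)

Section Blocks.
Variables (b m : nat).
Hypothesis b_gt0 : 0 < b.
Implicit Types (s : {perm 'I_m}) (k : 'I_m).

(* Sends the k-th block of b integers, k < m, to the (s k)-th one, and fixes
   the integers from m * b on. *)
Definition block_move s (x : nat) : nat :=
  if insub (x %/ b) is Some k then b * s k + x %% b else x.

Lemma block_move_block s k e : e < b -> block_move s (k * b + e) = b * s k + e.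
Proof.
move=> eb; rewrite /block_move divnMDl // divn_small // addn0 valK.
by rewrite modnMDl modn_small.
Qed.

Lemma block_move_out s x : m * b <= x -> block_move s x = x.
Proof. by move=> mx; rewrite /block_move insubN // -leqNgt leq_divRL. Qed.

Lemma block_cases x : x < m * b -> exists k e, e < b /\ x = k * b + e.
Proof.
rewrite -ltn_divLR // => xm; exists (Ordinal xm), (x %% b).
by split; [rewrite ltn_mod | apply: divn_eq].
Qed.

Lemma block_move_lt s x : (block_move s x < m * b) = (x < m * b).
Proof.
case: (ltnP x (m * b)) => [/block_cases[k [e [eb ->]]]|mx].
  rewrite block_move_block //.
  by have := leq_mul (ltn_ord (s k)) (leqnn b); lia.
by rewrite block_move_out // ltnNge mx.
Qed.

Lemma block_move_inj s : injective (block_move s).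
Proof.
move=> x y; have := block_move_lt s y; have := block_move_lt s x.
case: (ltnP x (m * b)) => [/block_cases[k [e [eb ->]]]|mx];
  case: (ltnP y (m * b)) => [/block_cases[l [e' [eb' ->]]]|my].
- move=> _ _; rewrite !block_move_block // ![b * _]mulnC => E.
  have := congr1 (divn^~ b) E; rewrite !divnMDl // !divn_small // !addn0.
  move=> /val_inj /perm_inj kl; move: E; rewrite kl.
  by move=> /addnI ->.
- by move=> + + E; rewrite E => ->.
- by move=> + + E; rewrite E => ->.
- by rewrite !block_move_out.
Qed.

Variables (n : nat) (n_gt0 : 0 < n).
Hypothesis mbn : m * b <= n.

(** [ord_mod] is only a cast here: [block_move] keeps numbers below [n] below [n], so nothing is
    reduced. *)
Definition block_perm s (x : 'I_n) : 'I_n := ord_mod n_gt0 (block_move s x).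

Lemma val_block_perm s x : block_perm s x = block_move s x :> nat.
Proof.
rewrite /= modn_small //; case: (ltnP x (m * b)) => mx.
  by apply: leq_trans mbn; rewrite block_move_lt.
by rewrite block_move_out.
Qed.

Lemma block_perm_inj s : injective (block_perm s).
Proof.
move=> x y /(congr1 (@nat_of_ord n)); rewrite !val_block_perm => /block_move_inj.
exact: val_inj.
Qed.

Lemma block_perm_block s k e : e < b ->
  block_perm s (ord_mod n_gt0 (k * b + e)) = ord_mod n_gt0 (b * s k + e).
Proof.
move=> eb; rewrite /block_perm; congr ord_mod; rewrite /= modn_small.
  exact: block_move_block.
by have := leq_mul (ltn_ord k) (leqnn b); lia.
Qed.

End Blocks.

(** * The language, its marked instances, and gluing *)

Definition unmarked : language.
Proof.
exists (fun n (G : labeled_graph n) => forall v, input G v = [::]).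
by move=> n G H [s [_ sI]] G0 v; rewrite -(permKV s v) sI G0.
Defined.

(** When [m * b < n], the name [n.-1] lies outside all blocks, so every block permutation fixes
    it. *)
Definition mark (n : nat) (y : 'I_n) : bits :=
  if y == n.-1 :> nat then [:: true] else [::].

(** [u] names the nodes by elements of ['I_n]. Inputs, and later identifiers and certificates, are
    read off the names, so different cycles can share them. *)
Definition marked_cycle (n : nat) (n_gt0 : 0 < n) (M : nat) (M_gt0 : 0 < M)
    (u : 'I_M -> 'I_n) : labeled_graph M :=
  LabeledGraph (cycle_network M_gt0) (fun x => mark (u x)).

Section Glue.
Variables (V : mixed_verifier) (m n : nat) (n_gt0 : 0 < n).
Let r := ver_radius V.
Let b := (2 * r).+1.
Hypotheses (bn : b < n) (mbn : m * b < n).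

Let accepts M (M_gt0 : 0 < M) (u : 'I_M -> 'I_n) glob (C : 'I_n -> bits) v :=
  node_accepts V (marked_cycle n_gt0 M_gt0 u) (fun x => (u x).+1) glob
    (fun x => C (u x)) v.

Lemma accepts_window M1 M2 (M1_gt0 : 0 < M1) (M2_gt0 : 0 < M2)
    (u1 : 'I_M1 -> 'I_n) (u2 : 'I_M2 -> 'I_n) s1 s2 glob C : b < M1 -> b < M2 ->
  (forall d, d <= 2 * r ->
     u1 (ord_mod M1_gt0 (s1 + d)) = u2 (ord_mod M2_gt0 (s2 + d))) ->
  accepts M1_gt0 u1 glob C (ord_mod M1_gt0 (s1 + r)) =
  accepts M2_gt0 u2 glob C (ord_mod M2_gt0 (s2 + r)).
Proof.
move=> bM1 bM2 u12; rewrite /accepts /node_accepts.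
congr (ver_accepts V glob _).
exact: (cycle_local_view_eq (fun y : 'I_n => y.+1)
  (fun y => (mark y, C y)) bM1 bM2 u12).
Qed.

Let b_gt0 : 0 < b := ltn0Sn _.
Let mbn_le : m * b <= n := ltnW mbn.

(** The blocks [s p], ..., [s q] are cut out of [s] and closed up. The seam from [s q = t i] to
    [s p = t j] occurs in the instance of [t], where [j] follows [i]. *)
Lemma accepts_glue (s t : {perm 'I_m}) glob C : s != t ->
  (forall v, accepts n_gt0 (block_perm b n_gt0 s) glob C v) ->
  (forall v, accepts n_gt0 (block_perm b n_gt0 t) glob C v) ->
  exists M (M_gt0 : 0 < M) (u : 'I_M -> 'I_n),
    [/\ injective u, forall x, mark (u x) = [::]
      & forall v, accepts M_gt0 u glob C v].
Proof.
move=> /perm_backward_step[i [j [p [q [ji pq spj sqi]]]]] accs acct.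
pose M := (q - p).+1 * b.
have M_gt0 : 0 < M by [].
(* As [p < q], the new cycle has at least two blocks, so no window closes up on itself. *)
have bM : b < M by rewrite /M; nia.
have qm : q * b + b <= m * b by have := leq_mul (ltn_ord q) (leqnn b); lia.
have pqM : p * b + M = q * b + b.
  by rewrite /M mulSn mulnBl; have := leq_mul (ltnW pq) (leqnn b); lia.
pose u (x : 'I_M) := block_perm b n_gt0 s (ord_mod n_gt0 (p * b + x)).
have u_inj : injective u.
  move=> x y /(block_perm_inj b_gt0 mbn_le)/(congr1 val) /=.
  have := ltn_ord x; have := ltn_ord y => yM xM.
  by rewrite !modn_small; [move=> /addnI /val_inj | lia | lia].
exists M, M_gt0, u; split=> // [x|v].
  (* Names taken from the blocks stay below [m * b], hence below the marked name [n.-1]. *)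
  rewrite /mark ifF //; apply: negbTE; rewrite neq_ltn; apply/orP; left.
  have := ltn_ord x => xM; rewrite (val_block_perm b_gt0) //.
  have : block_move b s (p * b + x) < m * b by rewrite block_move_lt //; lia.
  by rewrite /= modn_small; lia.
have [w [wM ->]] : exists w, w < M /\ v = ord_mod M_gt0 (w + r).
  exists ((v + (M - r)) %% M); split; first by rewrite ltn_mod.
  apply: val_inj; rewrite /= modnDml -addnA subnK; last by rewrite /b in bM; lia.
  by rewrite modnDr modn_small.
(* The window of v starts at w; it is a window of the instance of s unless it
   wraps around, and then it is a window of the instance of t, starting in t i. *)
case: (ltnP (w + 2 * r) M) => wr.
  rewrite (@accepts_window M n M_gt0 n_gt0 u (block_perm b n_gt0 s) w (p * b + w)) //.
  move=> d dr; rewrite /u; congr block_perm; congr ord_mod.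
  by rewrite /= modn_small ?addnA //; lia.
have [o wo] : exists o, w = (q - p) * b + o.
  by exists (w - (q - p) * b); rewrite subnKC //; rewrite /M mulSn /b in wr *; lia.
have ob : o < b by move: wM; rewrite wo /M mulSn; lia.
have M_eq : M = (q - p) * b + b by rewrite /M mulSn addnC.
rewrite (@accepts_window M n M_gt0 n_gt0 u (block_perm b n_gt0 t) w (i * b + o)) //.
(* Offsets before the seam lie in block [s q = t i]; later ones wrap around into [s p = t j]. *)
move=> d dr; rewrite /u; case: (ltnP (o + d) b) => od.
  have -> : p * b + ord_mod M_gt0 (w + d) = q * b + (o + d).
    by rewrite /= modn_small; lia.
  by rewrite -addnA !block_perm_block // sqi.
have odb : o + d - b < b by rewrite /b in ob od *; lia.
have -> : p * b + ord_mod M_gt0 (w + d) = p * b + (o + d - b).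
  have -> : w + d = o + d - b + M by lia.
  by rewrite /= modnDr modn_small //; lia.
have -> : i * b + o + d = j * b + (o + d - b) by rewrite ji mulSn; lia.
by rewrite !block_perm_block // spj.
Qed.

End Glue.

(** * Pigeonhole on certificates *)

Lemma fact_le_certificates (R : realType) (kappa : R) V (f g : nat -> nat) n :
  (1 <= kappa)%R -> correct_scheme kappa V (complement unmarked) f g ->
  (2 * ver_radius V).+1 < n ->
  (n.-1 %/ (2 * ver_radius V).+1)`! <= 2 ^ (g n).+1 * (2 ^ (f n).+1) ^ n.
Proof.
move=> kappa1 [complete sound] bn.
have n_gt0 : 0 < n by lia.
set b := (2 * _).+1 in bn *; set m := n.-1 %/ b.
have mbn : m * b < n by have := leq_trunc_div n.-1 b; rewrite -/m; lia.
rewrite leqNgt; apply/negP => few.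
pose bp (s : {perm 'I_m}) := block_perm b n_gt0 s.
have b_gt0 : 0 < b by [].
have bp_inj s : injective (bp s) by apply: block_perm_inj => //; apply: ltnW.
have /fin_all_exists[F FP] (s : {perm 'I_m}) : exists F : bits * ('I_n -> bits),
    [/\ size F.1 <= g n, forall y, size (F.2 y) <= f n
      & forall v, node_accepts V (marked_cycle n_gt0 n_gt0 (bp s))
          (fun x => (bp s x).+1) F.1 (fun x => F.2 (bp s x)) v].
  have [||bad|glob [cert [globP certP acc]]] :=
      complete n (marked_cycle n_gt0 n_gt0 (bp s)) (fun x => (bp s x).+1).
  - by split=> // x y /succn_inj/val_inj/bp_inj.
  - move=> v; apply: (@le_trans _ _ (n%:R)%R); first by rewrite ler_nat ltn_ord.
    by rewrite -[leLHS]powRr1 // ler_powR // ler1n.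
  - have last_lt : n.-1 < n by rewrite prednK.
    have marked : bp s (Ordinal last_lt) = n.-1 :> nat.
      rewrite (val_block_perm b_gt0 n_gt0 (ltnW mbn)) block_move_out //=.
      exact: leq_trunc_div.
    by have := bad (Ordinal last_lt); rewrite /= /mark marked eqxx.
  (* Certificates are reindexed from nodes to names, so that those of different instances become
     comparable. *)
  pose sg := perm (bp_inj s).
  exists (glob, fun y => cert (sg^-1%g y)); split=> //= v.
  have -> : (fun x => cert ((sg^-1)%g (bp s x))) = cert.
    by apply: funext => x; rewrite -(permE (bp_inj s)) permK.
  exact: acc.
have size1 s : size (F s).1 <= g n by case: (FP s).
have size2 s y : size ((F s).2 y) <= f n by case: (FP s).
pose code s : (g n).-bseq bool * {ffun 'I_n -> (f n).-bseq bool} :=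
  (Bseq (size1 s), [ffun y => Bseq (size2 s y)]).
(* Lengths are only bounded above, so all lengths up to [k] are summed; hence the exponent
   [k.+1]. *)
have card_bits k : #|{: k.-bseq bool}| <= 2 ^ k.+1.
  rewrite card_bseq card_bool; elim: k => [|k IHk].
    by rewrite big_ord_recl big_ord0.
  by rewrite big_ord_recr /= [leqRHS]expnS mul2n -addnn leq_add.
have [s [t [st code_st]]] : exists s t, s != t /\ code s = code t.
  case: (boolP [exists s, exists t, (s != t) && (code s == code t)]).
    by move=> /existsP[s /existsP[t /andP[st /eqP]]]; exists s, t.
  move=> inj; suff /leq_card : injective code.
    rewrite card_prod card_ffun card_ord card_Sn => le_code.
    have := leq_trans few le_code; rewrite ltnNge leq_mul // leq_exp2r //.
  move=> s t code_st; apply/eqP; apply: contraNT inj => st.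
  by apply/existsP; exists s; apply/existsP; exists t; rewrite st code_st eqxx.
have glob_st : (F s).1 = (F t).1 by have [] := code_st.
have cert_st y : (F s).2 y = (F t).2 y.
  by have [_ /ffunP/(_ y)] := code_st; rewrite !ffunE => /(congr1 val).
have [_ _ accs] := FP s; have [_ _ acct] := FP t.
rewrite -glob_st -(funext cert_st) in acct.
have [M [M_gt0 [u [u_inj u_unmarked acc]]]] := accepts_glue bn mbn st accs acct.
(* The glued cycle has [M < n] nodes but keeps identifiers and certificate lengths fitted to [n];
   soundness restricts neither. *)
have [|nL|v] := sound M (marked_cycle n_gt0 M_gt0 u) (fun x => (u x).+1) _ _
  (F s).1 (fun x => (F s).2 (u x)).
- by split=> // x y /succn_inj/val_inj/u_inj.
- exact: nL.
- by rewrite acc.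
Qed.

(** * From the counting inequality to logarithmic bounds *)

Local Open Scope ring_scope.

Theorem corollary8 (R : realType) (kappa : R) (hkappa : 1 <= kappa) :
  exists L : language,
    Lambda0 kappa L /\
    forall (V : mixed_verifier) (f g : nat -> nat),
      correct_scheme kappa V (complement L) f g ->
      exists c : R, 0 < c /\
        exists N : nat, forall n : nat, (N <= n)%N ->
          c * ln n%:R <= (f n)%:R \/ c * n%:R * ln n%:R <= (g n)%:R.
Proof.
exists unmarked; split.
  exists (LocalAlgorithm 0 (fun w => [forall x : view_nodes w, (val x).2 == [::]])).
  move=> n G ids _ _; split=> [acc v|G0 v] /=.
    have v_seen : (ids v, input G v) \in view_nodes (local_view G 0 ids (input G) v).
      apply/imfsetP; exists v => //=; rewrite inE; apply/existsP; exists ord0.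
      by apply/existsP; exists [tuple]; rewrite /= eqxx.
    by have /forallP/(_ [` v_seen]%fset)/eqP := acc v.
  apply/forallP => -[x /=] /imfsetP[u _ ->] /=.
  by rewrite G0.
move=> V f g scheme; pose b := (2 * ver_radius V).+1.
have d_gt0 : 0 < (64 * b)%:R :> R by rewrite ltr0n.
(* This constant and the threshold below are those of [certificates_lt_fact]. *)
exists (64 * b)%:R^-1; split; first by rewrite invr_gt0.
exists (2 ^ (64 * b))%N => n nb.
have n_gt0 : (0 < n)%N by apply: leq_trans nb; rewrite expn_gt0.
have bn : (b < n)%N.
  apply: leq_trans nb; apply: leq_trans (ltn_expl b (ltnSn 1)) _.
  by rewrite leq_exp2l //; lia.
(* The change of base costs nothing, since [ln 2 <= 1]. *)
have ln_le : ln n%:R <= (trunc_log 2 n).+1%:R :> R.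
  apply: (@le_trans _ _ (ln (2 ^+ (trunc_log 2 n).+1))).
    by rewrite ler_ln ?posrE ?ltr0n ?exprn_gt0 // -natrX ler_nat ltnW // trunc_log_ltn.
  rewrite lnXn // -(mulr_natr (ln _)) ler_piMl //.
  by apply: le_ln1Dx; lra.
have [cf|cf] := lerP ((64 * b)%:R^-1 * ln n%:R) (f n)%:R; first by left.
have [cg|cg] := lerP ((64 * b)%:R^-1 * n%:R * ln n%:R) (g n)%:R; first by right.
suff : (2 ^ (g n).+1 * (2 ^ (f n).+1) ^ n < (n.-1 %/ b)`!)%N.
  by rewrite ltnNge (fact_le_certificates hkappa scheme bn).
apply: certificates_lt_fact => //.
  rewrite -(ltr_nat R) natrM (lt_le_trans _ ln_le) //.
  by rewrite -ltr_pdivlMl.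
rewrite -(ltr_nat R) !natrM -natrM.
apply: (@lt_le_trans _ _ (n%:R * ln n%:R)); last by rewrite ler_wpM2l.
by rewrite -ltr_pdivlMl // mulrA.
Qed.
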